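(* Let $p$ be a prime, $r$ a non-negative integer, $q=p^r$, and $m\ge 1$ an integer. Then $$L(q,m)\le \mathsf{D}_m(\mathbb{Z}_q)\le U(q,m).$$
   Context: For a finite commutative ring $A$, a sequence over $A$ is a finite multiset $S=(a_1,\dots,a_\ell)$ of elements of $A$ (order disregarded, repetition allowed); its length $|S|=\ell$ counts multiplicity, and a subsequence is a sub-multiset. For an integer $m\ge1$ set $e_m(S)=\sum_{1\le i_1<\dots<i_m\le \ell}\prod_{j=1}^m a_{i_j}$. $\mathsf{D}_m(A)$ denotes the smallest positive integer $t$ such that every sequence $S$ over $A$ with $|S|\ge t$ contains a subsequence $S'$ with $|S'|\ge m$ and $e_m(S')=0$. Here $\mathbb{Z}_q$ is the ring of integers modulo $q$. For integers $n\ge1$, $m\ge1$, $L(n,m)$ is the smallest integer $t\ge m+1$ such that $\binom{t}{m}\equiv 0 \pmod n$. For $q=p^r$ and $m\ge1$, $U(q,m)$ is the smallest integer $t\ge m(q-1)+1$ such that $\sum_{0\le 2j\le m-1}\binom{t}{2j}\not\equiv \sum_{1\le 2j+1\le m-1}\binom{t}{2j+1}\pmod p$.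
   Formalization: The lower bound L(q,m) ≤ D_m(Z_q) is stated only for r ≥ 1: for r = 0 the ring Z_1 is zero, so D_m(Z_1) = m while L(1,m) = m+1, and the inequality fails for every m. The upper bound is stated for all r ≥ 0. *)

(* Defs.v *)
From HB Require Import structures.
From mathcomp Require Import all_boot all_order all_algebra.

Set Implicit Arguments.
Unset Strict Implicit.
Unset Printing Implicit Defensive.

Import GRing.Theory.
Local Open Scope ring_scope.

(* The ring Z/qZ for q >= 1. The library's 'Z_q is not used because 'Z_1 is    *)
(* Z/2Z; the predecessor makes Zmod 1 the trivial ring, which is why only a    *)
(* "possibly zero" (Pz) ring structure is available.                           *)
Definition Zmod (q : nat) : Type := 'I_q.-1.+1.

HB.instance Definition _ (q : nat) := Finite.on (Zmod q).
HB.instance Definition _ (q : nat) := GRing.Zmodule.on (Zmod q).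
HB.instance Definition _ (q : nat) :=
  GRing.Zmodule_isComPzRing.Build (Zmod q)
    (@Zp_mulA _) (@Zp_mulC _) (@Zp_mul1z _) (@Zp_mul_addl _).

(* An m-element set I of positions stands for the increasing tuple of its      *)
(* elements; repeated values at different positions are counted separately.    *)
Definition elem_sym (A : comPzRingType) (m : nat) (S : seq A) : A :=
  \sum_(I : {set 'I_(size S)} | #|I| == m) \prod_(i in I) tnth (in_tuple S) i.

Local Open Scope nat_scope.

Definition is_least (P : nat -> Prop) (t : nat) : Prop :=
  P t /\ forall s, P s -> t <= s.

(* Finite multisets are represented by lists: elem_sym is symmetric, and      *)
(* every sub-multiset of S can be listed in the order of S, i.e., as a subseq. *)
Definition is_D (m : nat) (A : finComPzRingType) : nat -> Prop :=
  is_least (fun t => 0 < t /\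
    forall S : seq A, t <= size S ->
      exists S' : seq A, [/\ subseq S' S, m <= size S' & elem_sym m S' = 0%R]).

Definition is_L (n m : nat) : nat -> Prop :=
  is_least (fun t => m + 1 <= t /\ 'C(t, m) = 0 %[mod n]).

(* With q = p ^ r. *)
Definition is_U (p r m : nat) : nat -> Prop :=
  is_least (fun t => m * (p ^ r - 1) + 1 <= t /\
    \sum_(0 <= i < m | ~~ odd i) 'C(t, i)
      <> \sum_(0 <= i < m | odd i) 'C(t, i) %[mod p]).

(* Main.v *)
(** Lower bound: for the sequence of t ones, [e_m] is the binomial t choose m,
    and t = m never gives 0 modulo [p ^ r > 1].

    Upper bound: index the subsequences of S by the sets X of positions, and
    lift S to natural numbers, so that [e_m] is a sum of monomials
    [J \subset X] with [#|J| = m].  By Lucas, [p ^ r] divides n exactly when p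
    divides the binomials of n over [p ^ i], [i < r].  Applied to a sum of n
    monomials of degree m, such a binomial is a polynomial of degree
    [m * p ^ i], so Fermat turns the indicator of [e_m = 0] into a polynomial
    over ['F_p] of degree [m * (p ^ r - 1) < |S|].  Its sum over all X weighted
    by [(-1) ^ #|X|] therefore vanishes; if only the X with [#|X| < m] were
    zeros of [e_m], that sum would be the alternating sum of binomials in the
    definition of U.  The latter equals
    [(-1) ^ (m - 1) * 'C(t - 1, m - 1)], so Pascal's rule shows that U exists. *)
Require Import Defs.
From mathcomp Require Import all_boot all_order all_algebra.
From mathcomp Require Import finfield.
From Stdlib Require Import Classical.

Set Implicit Arguments.
Unset Strict Implicit.
Unset Printing Implicit Defensive.

Import GRing.Theory.
Local Open Scope ring_scope.

(** * Polynomial functions on the subsets of a finite set *)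

(* The monomial \prod_(i in J) x_i takes the value (J \subset X)%:R at the     *)
(* indicator function of X, so f is a polynomial function of degree at most d. *)
Definition lowdeg (T : finType) (R : comNzRingType) (d : nat)
    (f : {set T} -> R) : Prop :=
  exists s : seq (R * {set T}), all (fun x : R * {set T} => #|x.2| <= d)%N s /\
    forall X, f X = \sum_(x <- s) x.1 * (x.2 \subset X)%:R.

Lemma eq_lowdeg (T : finType) (R : comNzRingType) d (f g : {set T} -> R) :
  f =1 g -> lowdeg d f -> lowdeg d g.
Proof. by move=> fg [s [sd fE]]; exists s; split=> // X; rewrite -fg. Qed.

Lemma lowdeg_mono (T : finType) (R : comNzRingType) (J : {set T}) :
  lowdeg #|J| (fun X => (J \subset X)%:R : R).
Proof.
by exists [:: (1, J)]; rewrite /= leqnn; split=> // X; rewrite big_seq1 mul1r.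
Qed.

Lemma lowdeg_cst (T : finType) (R : comNzRingType) d (c : R) :
  lowdeg d (fun _ : {set T} => c).
Proof.
exists [:: (c, set0)]; rewrite /= cards0; split=> // X.
by rewrite big_seq1 sub0set mulr1.
Qed.

Lemma lowdeg_le (T : finType) (R : comNzRingType) d e (f : {set T} -> R) :
  (d <= e)%N -> lowdeg d f -> lowdeg e f.
Proof.
move=> de [s [sd fE]]; exists s; split=> //.
by apply: sub_all sd => x /= xd; apply: leq_trans de.
Qed.

Lemma lowdegD (T : finType) (R : comNzRingType) d (f g : {set T} -> R) :
  lowdeg d f -> lowdeg d g -> lowdeg d (fun X => f X + g X).
Proof.
move=> [s [sd fE]] [t [td gE]]; exists (s ++ t); rewrite all_cat sd td.
by split=> // X; rewrite fE gE big_cat.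
Qed.

(** Variables are idempotent on indicator functions, so two monomials multiply to the monomial of
    the union [x.2 :|: y.2]. *)
Lemma lowdegM (T : finType) (R : comNzRingType) d e (f g : {set T} -> R) :
  lowdeg d f -> lowdeg e g -> lowdeg (d + e) (fun X => f X * g X).
Proof.
move=> [s [/allP sd fE]] [t [/allP te gE]].
exists [seq (x.1 * y.1, x.2 :|: y.2) | x <- s, y <- t]; split.
  apply/allP => _ /allpairsP [[x y] /= [xs yt ->]] /=.
  apply: leq_trans (leq_add (sd _ xs) (te _ yt)).
  by rewrite cardsU leq_subr.
move=> X; rewrite fE gE big_distrlr /= big_allpairs_dep /=.
apply: eq_bigr => x _; apply: eq_bigr => y _ /=.
by rewrite subUset -mulnb natrM mulrACA.
Qed.

Lemma lowdegX (T : finType) (R : comNzRingType) d k (f : {set T} -> R) :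
  lowdeg d f -> lowdeg (k * d) (fun X => f X ^+ k).
Proof.
move=> fd; elim: k => [|k IHk]; first exact: (lowdeg_cst _ _ 1).
by apply: eq_lowdeg (lowdegM fd IHk) => X; rewrite exprS.
Qed.

Lemma lowdeg_prod (T : finType) (R : comNzRingType) n (d : nat -> nat)
    (f : nat -> {set T} -> R) :
  (forall i, lowdeg (d i) (f i)) ->
  lowdeg (\sum_(i < n) d i)%N (fun X => \prod_(i < n) f i X).
Proof.
move=> fd; elim: n => [|n IHn].
  by apply: eq_lowdeg (lowdeg_cst _ _ 1) => X; rewrite big_ord0.
rewrite big_ord_recr.
by apply: eq_lowdeg (lowdegM IHn (fd n)) => X; rewrite big_ord_recr.
Qed.

(** Pascal's rule: prepending [J] to [s] adds [(J \subset X)%:R] times the binomial with [k] lowered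
    by one, so each unit of [k] costs degree [m]. *)
Lemma lowdeg_bin_count (T : finType) (R : comNzRingType) m k
    (s : seq {set T}) :
  all (fun J : {set T} => #|J| <= m)%N s ->
  lowdeg (k * m)
    (fun X => 'C(count (fun J : {set T} => J \subset X) s, k)%:R : R).
Proof.
elim: s k => [|J s IHs] k /=.
  by move=> _; apply: lowdeg_cst.
case/andP=> Jm sm; case: k => [|k].
  by apply: eq_lowdeg (lowdeg_cst _ _ 1) => X; rewrite bin0.
have dJ := lowdegM (lowdeg_le Jm (lowdeg_mono R J)) (IHs k sm).
apply: eq_lowdeg (lowdegD (IHs k.+1 sm) dJ) => X.
case: (J \subset X); first by rewrite mul1r add1n binS natrD.
by rewrite mul0r addr0 add0n.
Qed.

Lemma sum_sign_lowdeg (T : finType) (R : comNzRingType) d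
    (f : {set T} -> R) :
  lowdeg d f -> (d < #|T|)%N -> \sum_(X : {set T}) (-1) ^+ #|X| * f X = 0.
Proof.
move=> [s [/allP sd fE]] dT.
under eq_bigr => X _ do rewrite fE big_distrr /=.
(* Toggling some v outside J pairs off the sets X containing J. *)
rewrite exchange_big big_seq big1 // => -[c J] /sd /= Jd.
have /set0Pn [v] : ~: J != set0.
  by rewrite -card_gt0 -(ltn_add2l #|J|) addn0 cardsC (leq_ltn_trans Jd).
rewrite inE => vJ.
rewrite (bigID (fun X : {set T} => v \in X)) /=.
rewrite (reindex_onto (fun X => v |: X) (fun X => X :\ v)) /=; last first.
  by move=> X; apply: setD1K.
rewrite (eq_bigl (fun X : {set T} => v \notin X)); last first.
  move=> X; rewrite setU11 /=; case: (boolP (v \in X)) => vX; last first.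
    by rewrite setU1K ?eqxx.
  by apply/negP => /eqP EX; move: vX; rewrite -EX !inE eqxx.
rewrite -big_split big1 //= => X vX.
have -> : (J \subset v |: X) = (J \subset X).
  apply/subsetP/subsetP => JX x xJ; last by rewrite inE JX ?orbT.
  by case/setU1P: (JX x xJ) => // xv; rewrite -xv xJ in vJ.
by rewrite cardsU1 vX exprS mulN1r mulNr addNr.
Qed.

(** * Divisibility by prime powers through binomials mod [p] *)

Lemma prime_dvd_bin_pexp p i j :
  prime p -> (0 < j < p ^ i)%N -> (p %| 'C(p ^ i, j))%N.
Proof.
case: j => // j p_pr /andP [_ ji].
case: (boolP (p %| _)%N) => // npC.
(* Absorption identity: if the binomial were coprime to [p], then [p ^ i] would divide the smaller
   number [j.+1]. *)
have: (p ^ i %| j.+1 * 'C(p ^ i, j.+1))%N by rewrite -mul_bin_diag dvdn_mulr.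
rewrite Gauss_dvdl; last by rewrite coprimeXl // prime_coprime.
by move/dvdn_leq => /(_ isT); rewrite leqNgt ji.
Qed.

Lemma bin_pexp_mod p i u :
  prime p -> 'C(p ^ i * u, p ^ i) = u %[mod p].
Proof.
move=> p_pr; have q0 : (0 < p ^ i)%N by rewrite expn_gt0 prime_gt0.
elim: u => [|u IHu]; first by rewrite muln0 bin0n eqn0Ngt q0.
(* Vandermonde for [p ^ i + p ^ i * u]: the first term is the binomial for [u], the last is 1, and
   [p] divides all the others. *)
rewrite mulnS -binomial.Vandermonde -(prednK q0) big_ord_recl big_ord_recr /=.
rewrite (prednK q0) bin0 mul1n subn0 /bump /= add1n (prednK q0) binn subnn bin0.
rewrite muln1 addnCA -modnDml; set M := bigop _ _ _.
have /eqP -> : (p %| M)%N.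
  apply: dvdn_sum => j _; apply/dvdn_mulr/prime_dvd_bin_pexp => //.
  by rewrite add1n -ltn_predRL ltn_ord.
by rewrite add0n -modnDml IHu modnDml addn1.
Qed.

Lemma Fp_eq0 p n : prime p -> (n%:R == 0 :> 'F_p) = (p %| n)%N.
Proof. by move=> p_pr; rewrite -(dvdn_pcharf (pchar_Fp p_pr)). Qed.

Lemma Fp_fermat p (x : 'F_p) : prime p -> 1 - x ^+ p.-1 = (x == 0)%:R.
Proof.
move=> p_pr; have p1 := prime_gt1 p_pr.
have [->|x0] := eqVneq; first by rewrite expr0n -subn1 subn_eq0 leqNgt p1 subr0.
apply/eqP; rewrite subr_eq0 eq_sym; apply/eqP; apply: (mulfI x0).
by rewrite -exprS (prednK (ltnW p1)) mulr1 -[RHS]expf_card card_Fp.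
Qed.

(** Induction on [r]: if [n = u * p ^ r], the next factor tests whether [p] divides [u]; otherwise
    the product is already 0. *)
Lemma prod_bin_pexp_dvdn p r n : prime p ->
  \prod_(i < r) (1 - 'C(n, p ^ i)%:R ^+ p.-1) = (p ^ r %| n)%:R :> 'F_p.
Proof.
move=> p_pr; elim: r => [|r IHr]; first by rewrite big_ord0 dvd1n.
rewrite big_ord_recr /= {}IHr Fp_fermat // Fp_eq0 //.
have [/dvdnP [u ->]|nrn] := boolP (p ^ r %| n)%N; last first.
  rewrite mul0r; case: (boolP (_ %| _)%N) => // rn.
  by case/negP: nrn; apply: dvdn_trans rn; rewrite expnS dvdn_mull.
rewrite mul1r [(u * _)%N]mulnC /dvdn bin_pexp_mod // expnSr.
by rewrite -[in RHS]muln_modr muln_eq0 expn_eq0 -[p == _]leqn0 leqNgt prime_gt0.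
Qed.

(** * Alternating sums of binomials *)

Lemma sum_sign_bin (R : comNzRingType) s k :
  \sum_(0 <= i < k.+1) (-1) ^+ i * 'C(s.+1, i)%:R = (-1) ^+ k * 'C(s, k)%:R :> R.
Proof.
elim: k => [|k IHk]; first by rewrite big_nat1 !bin0.
rewrite big_nat_recr //= IHk binS natrD mulrDr exprS.
by rewrite !mulN1r !mulNr addrCA subrr addr0.
Qed.

(** Moves the condition of [is_U] into ['F_p], where the two parity sums become one alternating
    sum. *)
Lemma parity_sum_mod p (F : nat -> nat) m : prime p ->
  (\sum_(0 <= i < m | ~~ odd i) F i = \sum_(0 <= i < m | odd i) F i %[mod p])%N
  <-> \sum_(0 <= i < m) (-1) ^+ i * (F i)%:R = 0 :> 'F_p.
Proof.
move=> p_pr.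
have -> : \sum_(0 <= i < m) (-1) ^+ i * (F i)%:R
    = (\sum_(0 <= i < m | ~~ odd i) F i)%N%:R
      - (\sum_(0 <= i < m | odd i) F i)%N%:R :> 'F_p.
  rewrite (bigID odd) [LHS]addrC !natr_sum -sumrN; congr (_ + _).
    by apply: eq_bigr => i /= /negbTE oi; rewrite -signr_odd oi mul1r.
  by apply: eq_bigr => i /= oi; rewrite -signr_odd oi mulN1r.
split=> [EO|/eqP].
  by apply/eqP; rewrite subr_eq0 -Fp_nat_mod // EO Fp_nat_mod.
by rewrite subr_eq0 => /eqP /(congr1 val) /=; rewrite !val_Fp_nat.
Qed.

Lemma sum_sign_small (R : comNzRingType) (T : finType) m :
  \sum_(X : {set T}) (-1) ^+ #|X| * (#|X| < m)%:R
    = \sum_(0 <= i < m) (-1) ^+ i * 'C(#|T|, i)%:R :> R.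
Proof.
(* Each indicator is spread over the possible sizes [i], so that exchanging the sums counts the sets
   of each size. *)
rewrite (eq_bigr (fun X : {set T} =>
  \sum_(0 <= i < m) (-1) ^+ i * (#|X| == i)%:R)); last first.
  move=> X _; have [Xm|mX] := ltnP.
    rewrite (bigD1_seq #|X|) ?mem_index_iota ?iota_uniq //= eqxx big1 ?addr0 //.
    by move=> i /negbTE; rewrite eq_sym => ->; rewrite mulr0.
  rewrite big_nat big1 ?mulr0 // => i /andP [_ im].
  by rewrite (gtn_eqF (leq_trans im mX)) mulr0.
rewrite exchange_big; apply: eq_bigr => i _ /=.
rewrite -big_distrr /= -card_draws -sum1_card natr_sum.
rewrite [in RHS]big_mkcond; congr (_ * _).
by apply: eq_bigr => X _; rewrite inE; case: eqP.
Qed.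

(** * Elementary symmetric functions over [Zmod q] *)

Lemma elem_sym_map (A : comPzRingType) (T : finType) (g : T -> A) m
    (s : seq T) :
  uniq s ->
  elem_sym m (map g s) =
  \sum_(I : {set T} | (I \subset s) && (#|I| == m)) \prod_(i in I) g i.
Proof.
move=> us.
(* As [s] has no repetitions, [h] is a bijection from positions to elements of [s], and its images
   reindex the sum. *)
pose h (k : 'I_(size (map g s))) :=
  tnth (in_tuple s) (cast_ord (size_map g s) k).
have hE k : tnth (in_tuple (map g s)) k = g (h k).
  have ks : (k < size s)%N by rewrite -(size_map g).
  by rewrite (tnth_nth (g (h k))) /= (nth_map (h k)) // {2}/h (tnth_nth (h k)).
have hs k : h k \in s by apply: (mem_tnth _ (in_tuple s)).
have h_inj : injective h.
  move=> k l; rewrite /h => /eqP.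
  rewrite (tnth_nth (h k)) [X in _ == X](tnth_nth (h k)) /=.
  by rewrite nth_uniq ?(leq_trans (ltn_ord _)) ?size_map // => /eqP /val_inj.
have h_surj x : x \in s -> exists k, x = h k.
  move=> xs; have ks : (index x s < size (map g s))%N.
    by rewrite size_map index_mem.
  by exists (Ordinal ks); rewrite /h (tnth_nth x) /= nth_index.
rewrite /elem_sym.
rewrite (reindex_onto (fun I : {set _} => h @: I) (fun J => h @^-1: J)) /=.
  apply: eq_big => [I|I _]; last first.
    rewrite big_imset /=; last by move=> ? ? _ _; apply: h_inj.
    by apply: eq_bigr => k _; rewrite hE.
  rewrite card_imset //.
  have -> : (h @: I \subset s) by apply/subsetP => _ /imsetP [k _ ->].
  have -> : (h @^-1: (h @: I) == I).
    by apply/eqP/setP => k; rewrite inE mem_imset.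
  by rewrite andbT.
move=> J /andP [/subsetP Js _]; apply/setP => x; apply/imsetP/idP => [[k]|xJ].
  by rewrite inE => ? ->.
by have [k xk] := h_surj x (Js x xJ); exists k; rewrite // inE -xk.
Qed.

Lemma Zmod_natrE q n : n%:R = inZp n :> Zmod q.
Proof.
elim: n => [|n IHn]; first by apply: val_inj; rewrite /= mod0n.
by rewrite mulrSr IHn; apply: val_inj; rewrite /= modnDm addn1.
Qed.

Lemma Zmod_natr_eq0 q n : (0 < q)%N -> (n%:R = 0 :> Zmod q) <-> (q %| n)%N.
Proof.
move=> q0; rewrite Zmod_natrE; split=> [/(congr1 val) /=|/eqP qn].
  by rewrite (prednK q0) => /eqP.
by apply: val_inj; rewrite /= (prednK q0).
Qed.

Lemma Zmod_natr_val q (x : Zmod q) : (val x)%:R = x.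
Proof. by rewrite Zmod_natrE; apply: valZpK. Qed.

(** * Zero subsequences from the degree bound *)

Lemma lowdeg_dvdn_count (T : finType) p r m (s : seq {set T}) :
  prime p -> all (fun J : {set T} => #|J| <= m)%N s ->
  lowdeg (m * (p ^ r).-1)
    (fun X => (p ^ r %| count (fun J : {set T} => J \subset X) s)%:R : 'F_p).
Proof.
move=> p_pr sm.
have dC i := lowdegX p.-1 (lowdeg_bin_count 'F_p (p ^ i) sm).
have dB i := lowdegD (lowdeg_cst T (p.-1 * (p ^ i * m)) 1)
  (lowdegM (lowdeg_cst T 0 (-1)) (dC i)).
(* The degrees of the factors add up as a geometric sum. *)
have -> : (m * (p ^ r).-1 = \sum_(i < r) p.-1 * (p ^ i * m))%N.
  rewrite predn_exp mulnCA !big_distrr.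
  by apply: eq_bigr => i _; rewrite /= [(m * _)%N]mulnC.
have dP := lowdeg_prod r dB.
apply: eq_lowdeg dP => X; rewrite -prod_bin_pexp_dvdn //.
by apply: eq_bigr => i _; rewrite mulN1r.
Qed.

(** Listing each index set as often as its lifted monomial's value turns [e_m] into a count, the
    form that [lowdeg_bin_count] handles. *)
Lemma elem_sym_enum q m (S : seq (Zmod q)) :
  exists s : seq {set 'I_(size S)},
    all (fun J : {set _} => #|J| == m) s /\
    forall X : {set 'I_(size S)},
      elem_sym m [seq tnth (in_tuple S) i | i <- enum X]
      = (count (fun J : {set _} => J \subset X) s)%:R.
Proof.
pose c (I : {set 'I_(size S)}) := (\prod_(i in I) val (tnth (in_tuple S) i))%N.
exists (flatten [seq nseq (c K) K |
                 K <- enum [pred K : {set 'I_(size S)} | #|K| == m]]).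
split=> [|X].
  apply/allP => J /flattenP [_ /mapP [K Km ->]]; rewrite mem_enum inE in Km.
  by rewrite mem_nseq => /andP [_ /eqP ->].
rewrite elem_sym_map ?enum_uniq // count_flatten sumnE !big_map big_enum /=.
rewrite natr_sum [LHS]big_mkcondl /=.
apply: eq_big => // I _; rewrite count_nseq.
have -> : (I \subset enum X) = (I \subset X).
  by apply: eq_subset_r => i; rewrite mem_enum.
case: (I \subset X); rewrite ?mul0n // mul1n natr_prod.
by apply: eq_bigr => i _; rewrite Zmod_natr_val.
Qed.

Lemma zero_subseq p r m (S : seq (Zmod (p ^ r))) : prime p ->
  (m * (p ^ r - 1) < size S)%N ->
  \sum_(0 <= i < m) (-1) ^+ i * 'C(size S, i)%:R != 0 :> 'F_p ->
  exists S', [/\ subseq S' S, (m <= size S')%N & elem_sym m S' = 0].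
Proof.
move=> p_pr Sq /eqP alt_neq0; apply: NNPP => noS'; apply: alt_neq0.
have [s [sm sE]] := elem_sym_enum m S.
have sm' : all (fun J : {set _} => #|J| <= m)%N s.
  by apply: sub_all sm => J /eqP ->.
under eq_bigr => i _ do rewrite -(card_ord (size S)).
rewrite -sum_sign_small.
rewrite subn1 in Sq; have d := lowdeg_dvdn_count r p_pr sm'.
rewrite -[RHS](sum_sign_lowdeg d) ?card_ord //.
apply: eq_bigr => X _; congr (_ * (nat_of_bool _)%:R).
(* If [#|X| < m], no [J] of size [m] fits in [X] and the count is 0; a zero at any other [X] would
   give the excluded [S']. *)
apply/idP/idP => [Xm|/Zmod_natr_eq0 eX].
  rewrite (eq_in_count (a2 := pred0)) ?count_pred0 // => J /(allP sm) /eqP Jm.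
  by apply/negP => /subset_leq_card; rewrite Jm leqNgt Xm.
rewrite ltnNge; apply/negP => mX; apply: noS'.
exists [seq tnth (in_tuple S) i | i <- enum X]; split.
- rewrite -[X in subseq _ X](map_tnth_enum (in_tuple S)); apply: map_subseq.
  by rewrite {1}/enum_mem -enumT filter_subseq.
- by rewrite size_map -cardE.
by rewrite sE eX // expn_gt0 prime_gt0.
Qed.

Local Close Scope ring_scope.

(** * Existence of the constants and the two bounds *)

Lemma exists_least (P : nat -> Prop) :
  (exists n, P n) -> exists t, is_least P t.
Proof.
case=> n; elim/ltn_ind: n => n IHn Pn.
have [[k [kn Pk]]|noP] := classic (exists k, k < n /\ P k); first exact: IHn Pk.
exists n; split=> // s Ps; rewrite leqNgt; apply/negP => sn.
by apply: noP; exists s.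
Qed.

(** If [p] divides ['C(t, k.+1)] but not ['C(t, k)], Pascal's rule makes [t.+1] work. *)
Lemma bin_not_dvdn_cofinal p k N :
  prime p -> exists2 t, N <= t & ~~ (p %| 'C(t, k)).
Proof.
move=> p_pr; elim: k => [|k [t Nt pC]].
  by exists N; rewrite // bin0 dvdn1 neq_ltn prime_gt1 ?orbT.
have [pCt|npCt] := boolP (p %| 'C(t, k.+1)); last by exists t.
by exists t.+1; [apply: leqW | rewrite binS dvdn_addr].
Qed.

Lemma is_L_exists n m : 0 < n -> 0 < m -> exists L, is_L n m L.
Proof.
(* The factor [m.+1] secures the lower bound on the witness; the factor [m]! cancels the denominator
   of the binomial. *)
move=> n0 m0; apply: exists_least; exists (n * m`! * m.+1).
have f0 := fact_gt0 m; split.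
  by rewrite addn1 leq_pmull // muln_gt0 n0.
apply/eqP; rewrite mod0n -/(dvdn n _) -(dvdn_pmul2r f0) bin_ffact.
by case: m m0 {f0} => // m _; rewrite ffactnS dvdn_mulr // dvdn_mulr.
Qed.

Lemma is_U_exists p r m : prime p -> 0 < m -> exists U, is_U p r m U.
Proof.
move=> p_pr; case: m => // m _; apply: exists_least.
(* At [t.+1] the alternating sum collapses to ['C(t, m)] up to sign, whence the shift in the
   witness. *)
have [t Nt pC] := bin_not_dvdn_cofinal m (m.+1 * (p ^ r - 1)) p_pr.
exists t.+1; rewrite addn1; split=> // /(parity_sum_mod _ _ p_pr).
rewrite sum_sign_bin => /eqP.
by rewrite mulf_eq0 signr_eq0 /= Fp_eq0 // (negbTE pC).
Qed.

Lemma elem_sym_ones (A : comPzRingType) m n :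
  elem_sym m (nseq n (1%R : A)) = ('C(n, m))%:R%R.
Proof.
rewrite /elem_sym (eq_bigr (fun=> 1%R)) => [|I _]; last first.
  by rewrite big1 // => i _; rewrite (tnth_nth 1%R) nth_nseq if_same.
rewrite sumr_const -[X in 'C(X, _)](size_nseq n (1%R : A)).
rewrite -[X in 'C(X, _)]card_ord -card_draws.
by congr (_ *+ _)%R; apply: eq_card => I; rewrite inE.
Qed.

(** For [r = 0] the ring is trivial, so [D = m] while [L = m + 1]; hence the condition [0 < r]. *)
Theorem theorem3 (p r m : nat) (p_prime : prime p) (m_ge1 : 1 <= m) :
  exists L D U : nat,
    [/\ is_L (p ^ r) m L,
        is_D m (Zmod (p ^ r)) D,
        is_U p r m U,
        (0 < r -> L <= D) & D <= U].
Proof.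
have q0 : 0 < p ^ r by rewrite expn_gt0 prime_gt0.
have [L L_least] := is_L_exists q0 m_ge1.
have [U U_least] := is_U_exists r p_prime m_ge1.
have U_good : 0 < U /\ forall S : seq (Zmod (p ^ r)), U <= size S ->
    exists S', [/\ subseq S' S, m <= size S' & elem_sym m S' = 0%R].
  case: U_least => -[mU /(parity_sum_mod _ _ p_prime)/eqP altU] _.
  rewrite addn1 in mU; split=> [|S US]; first exact: leq_ltn_trans mU.
  (* The alternating sum is known to be nonzero at length [U] itself, so longer sequences are
     truncated. *)
  have sz : size (take U S) = U by rewrite size_takel.
  have [||S' [S'S mS' eS']] := @zero_subseq p r m (take U S) p_prime.
  - by rewrite sz.
  - by rewrite sz.
  by exists S'; split=> //; apply: subseq_trans S'S (take_subseq _ _).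
have [D D_least] : exists D, is_D m (Zmod (p ^ r)) D.
  by apply: exists_least; exists U.
exists L, D, U; split=> //; last by case: D_least => _; apply.
move=> r0; case: D_least => -[_ D_good] _; case: L_least => _ L_min.
have [|S' [S'1 mS' eS']] := D_good (nseq D 1%R); first by rewrite size_nseq.
have sD : size S' <= D.
  by rewrite -(size_nseq D (1%R : Zmod (p ^ r))) size_subseq.
have S'E : S' = nseq (size S') 1%R.
  by apply/all_pred1P/allP => x /(mem_subseq S'1); rewrite mem_nseq => /andP [].
move: eS'; rewrite S'E elem_sym_ones => /Zmod_natr_eq0 qC.
apply: leq_trans (L_min (size S') _) sD; split; last first.
  by apply/eqP; rewrite mod0n; apply: qC.
(* Length exactly [m] would make [p ^ r] divide ['C(m, m) = 1], against [0 < r]. *)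
rewrite addn1 ltn_neqAle mS' andbT; apply/eqP => mE.
move: (qC q0); rewrite -mE binn dvdn1 => /eqP qE.
by move: (ltn_expl r (prime_gt1 p_prime)); rewrite qE ltnNge r0.
Qed.
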